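(* Let $m,n\ge1$, $\mathbf q=(q_1,\dots,q_m)\in(\mathbb C^* )^m$, and write $\mathbf t=(t_1,\dots,t_m)$, $\bar{\mathbf t}=(q_1t_1,\dots,q_mt_m)$, $\mathbf y=(y_1,\dots,y_n)$. Let $H=(H_1,\dots,H_n)$ be holomorphic at $(\mathbf t,\mathbf y)=(\mathbf 0,\mathbf Y)$ for some $\mathbf Y\in\mathbb C^n$ with $H(\mathbf 0,\mathbf Y)=\mathbf Y$, and suppose no eigenvalue of the Jacobian $D=\big(\frac{\partial H_j}{\partial y_k}(\mathbf 0,\mathbf Y)\big)_{j,k}$ lies in $Q=\{\mathbf q^\alpha:\alpha\in\mathbb N^m\setminus\{0\}\}$. Then the system $y_j(\bar{\mathbf t})=H_j(\mathbf t,\mathbf y(\mathbf t))$ ($1\le j\le n$) has a unique formal power series solution of the form $y_j(\mathbf t)=Y_j+\sum_{\alpha\in\mathbb N^m\setminus\{0\}}b^{(j)}_\alpha\mathbf t^\alpha$. If moreover no eigenvalue of $D$ is a limit point of $Q$, these power series converge in a neighbourhood of $\mathbf t=\mathbf 0$.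
   Context: Multi-index notation: for $\alpha\in\mathbb N^m$, $\mathbf q^\alpha=q_1^{\alpha_1}\cdots q_m^{\alpha_m}$ and $\mathbf t^\alpha=t_1^{\alpha_1}\cdots t_m^{\alpha_m}$. *)

(* Defs.v *)
From Stdlib Require Import Reals List Arith.
Import ListNotations.
Open Scope R_scope.

Definition Cplx : Type := (R * R)%type.
Definition C0 : Cplx := (0, 0).
Definition C1 : Cplx := (1, 0).
Definition Cadd (x y : Cplx) : Cplx := (fst x + fst y, snd x + snd y).
Definition Copp (x : Cplx) : Cplx := (- fst x, - snd x).
Definition Csub (x y : Cplx) : Cplx := Cadd x (Copp y).
Definition Cmul (x y : Cplx) : Cplx :=
  (fst x * fst y - snd x * snd y, fst x * snd y + snd x * fst y).
Definition Cnorm (x : Cplx) : R := sqrt (fst x * fst x + snd x * snd x).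
Fixpoint Cpow (x : Cplx) (k : nat) : Cplx :=
  match k with O => C1 | S k' => Cmul x (Cpow x k') end.
Definition Csum {A : Type} (f : A -> Cplx) (l : list A) : Cplx :=
  fold_right (fun a acc => Cadd (f a) acc) C0 l.
Definition Rsum {A : Type} (f : A -> R) (l : list A) : R :=
  fold_right (fun a acc => f a + acc) 0 l.

(** * Multi-indices: a multi-index in N^m is a list of nat of length m. *)
Definition midx := list nat.
Definition total (a : midx) : nat := fold_right Nat.add 0%nat a.
Definition is_zero_idx (a : midx) : bool := forallb (Nat.eqb 0) a.
Definition zero_idx (m : nat) : midx := repeat 0%nat m.
Definition unit_idx (n k : nat) : midx :=
  map (fun i => if Nat.eqb i k then 1%nat else 0%nat) (seq 0 n).
Fixpoint below (a : midx) : list midx :=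
  match a with
  | [] => [ [] ]
  | x :: a' => flat_map (fun i => map (cons i) (below a')) (seq 0 (S x))
  end.
Fixpoint idx_sub (a b : midx) : midx :=
  match a, b with
  | x :: a', y :: b' => (x - y)%nat :: idx_sub a' b'
  | _, _ => a
  end.
Fixpoint comps (n d : nat) : list midx :=
  match n with
  | O => [ [] ]
  | S n' => flat_map (fun i => map (cons i) (comps n' (d - i))) (seq 0 (S d))
  end.

Fixpoint qpow_from (q : nat -> Cplx) (i : nat) (a : midx) : Cplx :=
  match a with
  | [] => C1
  | x :: a' => Cmul (Cpow (q i) x) (qpow_from q (S i) a')
  end.
Definition qpow (q : nat -> Cplx) (a : midx) : Cplx := qpow_from q 0 a.

(** * Formal power series in m variables t_1..t_m:
    coefficient functions on multi-indices (only indices of length m matter). *)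
Definition ps := midx -> Cplx.
Definition ps_one : ps := fun a => if is_zero_idx a then C1 else C0.
Definition ps_mul (f g : ps) : ps :=
  fun a => Csum (fun b => Cmul (f b) (g (idx_sub a b))) (below a).
Fixpoint ps_pow (f : ps) (k : nat) : ps :=
  match k with O => ps_one | S k' => ps_mul f (ps_pow f k') end.
Fixpoint ps_prod_pows (z : nat -> ps) (i : nat) (g : midx) : ps :=
  match g with
  | [] => ps_one
  | x :: g' => ps_mul (ps_pow (z i) x) (ps_prod_pows z (S i) g')
  end.

(** A function H_j holomorphic at (t,y) = (0,Y) in Cplx^m x Cplx^n is given by its
    Taylor expansion  H_j(t,y) = sum_{beta,gamma} c beta gamma t^beta (y-Y)^gamma,
    with c : N^m -> N^n -> Cplx absolutely convergent on some polydisc. *)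
Definition analytic_coeffs (m n : nat) (c : midx -> midx -> Cplx) : Prop :=
  exists r M : R, 0 < r /\ forall d : nat,
    Rsum (fun b => Rsum (fun g =>
       Cnorm (c b g) * r ^ (total b + total g)) (comps n d)) (comps m d) <= M.

Definition ps_converges (m : nat) (f : ps) : Prop :=
  exists r M : R, 0 < r /\ forall d : nat,
    Rsum (fun a => Cnorm (f a) * r ^ (total a)) (comps m d) <= M.

(** Coefficient at t^alpha of the formal series
      H_j(t, y(t)) = sum_{beta,gamma} c beta gamma t^beta prod_k (y_k(t)-Y_k)^{gamma_k},
    where z_k = y_k - Y_k has zero constant term (so the sum is finite:
    only |gamma| <= |alpha| contribute). *)
Definition comp_coef (n : nat) (cj : midx -> midx -> Cplx) (z : nat -> ps)
  (a : midx) : Cplx :=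
  Csum (fun b => Csum (fun g =>
     Cmul (cj b g) (ps_prod_pows z 0 g (idx_sub a b))) (comps n (total a)))
   (below a).

(* z_k = y_k - Y_k when y_k has constant term Y_k *)
Definition shift_series (y : nat -> ps) : nat -> ps :=
  fun k a => if is_zero_idx a then C0 else y k a.

(** y = (y_1..y_n) (formal series in t) solves y_j(q t) = H_j(t, y(t)),
    with y_j(t) = Y_j + sum_{alpha <> 0} b_alpha t^alpha. *)
Definition is_solution (m n : nat) (q : nat -> Cplx) (Y : nat -> Cplx)
  (c : nat -> midx -> midx -> Cplx) (y : nat -> ps) : Prop :=
  (forall j, (j < n)%nat -> y j (zero_idx m) = Y j) /\
  (forall j a, (j < n)%nat -> length a = m ->
     Cmul (qpow q a) (y j a) = comp_coef n (c j) (shift_series y) a).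

(** Jacobian D_{jk} = dH_j/dy_k (0,Y) = Taylor coefficient of (y_k - Y_k). *)
Definition jacobian (m n : nat) (c : nat -> midx -> midx -> Cplx) (j k : nat) : Cplx :=
  c j (zero_idx m) (unit_idx n k).

Definition is_eigenvalue (n : nat) (D : nat -> nat -> Cplx) (lam : Cplx) : Prop :=
  exists v : nat -> Cplx, (exists k, (k < n)%nat /\ v k <> C0) /\
    forall j, (j < n)%nat -> Csum (fun k => Cmul (D j k) (v k)) (seq 0 n) = Cmul lam (v j).

Definition in_Q (m : nat) (q : nat -> Cplx) (lam : Cplx) : Prop :=
  exists a : midx, length a = m /\ is_zero_idx a = false /\ lam = qpow q a.

Definition limit_point_Q (m : nat) (q : nat -> Cplx) (lam : Cplx) : Prop :=
  forall eps : R, 0 < eps -> exists a : midx, length a = m /\ is_zero_idx a = false /\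
    qpow q a <> lam /\ Cnorm (Csub (qpow q a) lam) < eps.

(* Main.v *)
(** Split [H_j(t, Y + z)] into its linear part [D z] and the nonlinear rest.  The coefficient
    of the rest at [t^alpha] involves only coefficients of [z] of lower total degree, so
    the equation becomes the recursion [(q^alpha - D) z_alpha = rest_alpha], which is
    uniquely solvable because [q^alpha] is not an eigenvalue of [D].

    If no eigenvalue is a limit point of [Q], a compactness argument bounds
    [(q^alpha - D)^{-1}] uniformly by some [K].  With the truncated weighted norms
    [N_d(f) = sum_{|alpha| <= d} |f_alpha| rho^|alpha|], which are submultiplicative, a bound
    [N_d(z_j) <= s] on the part of degree at most [k] gives
    [N_d(rest_j) <= M (rho / r + (s / r)^2)] on the part of degree at most [k + 1].  Choosing
    [s], and then [rho], small enough makes [n K] times the right-hand side at most [s], and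
    the bound propagates to all degrees. *)

From Stdlib Require Import Reals List Arith Lra Lia Permutation Classical
  ClassicalEpsilon FunctionalExtensionality.
From Coquelicot Require Complex.
Require Import Defs.
Import ListNotations.
Open Scope R_scope.

(** * Complex arithmetic and the modulus *)

Lemma Cplx_ring : ring_theory C0 C1 Cadd Cmul Csub Copp (@eq Cplx).
Proof.
  split; intros; apply injective_projections; cbn; ring.
Qed.

Add Ring Cplx_ring : Cplx_ring.

(** Bridge to Coquelicot: both types are pairs of reals, so the triangle inequality,
    multiplicativity and inverses transfer directly. *)
Lemma Cnorm_Cmod x : Cnorm x = Complex.Cmod x.
Proof. unfold Cnorm, Complex.Cmod; f_equal; ring. Qed.

Lemma Cnorm_ge0 x : 0 <= Cnorm x.
Proof. apply sqrt_pos. Qed.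

Lemma Cnorm_0 : Cnorm C0 = 0.
Proof. rewrite Cnorm_Cmod; apply Complex.Cmod_0. Qed.

Lemma Cnorm_1 : Cnorm C1 = 1.
Proof. rewrite Cnorm_Cmod; apply Complex.Cmod_1. Qed.

Lemma Cnorm_add x y : Cnorm (Cadd x y) <= Cnorm x + Cnorm y.
Proof. rewrite !Cnorm_Cmod; apply Complex.Cmod_triangle. Qed.

Lemma Cnorm_mul x y : Cnorm (Cmul x y) = Cnorm x * Cnorm y.
Proof. rewrite !Cnorm_Cmod; apply Complex.Cmod_mult. Qed.

Lemma Cinv_exists x : x <> C0 -> exists u, Cmul x u = C1.
Proof. intros H; exists (Complex.Cinv x); exact (Complex.Cinv_r x H). Qed.

Lemma Csub_eq0 x y : Csub x y = C0 -> x = y.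
Proof. intros H; replace x with (Cadd (Csub x y) y) by ring; rewrite H; ring. Qed.

(** * Finite sums *)

Section Sums.
Context {A : Type}.
Implicit Types (l : list A).

Lemma Csum_ext (f g : A -> Cplx) l :
  (forall x, In x l -> f x = g x) -> Csum f l = Csum g l.
Proof.
  induction l as [|x l IH]; cbn; intros H; auto.
  f_equal; auto.
Qed.

Lemma Csum_add (f g : A -> Cplx) l :
  Csum (fun x => Cadd (f x) (g x)) l = Cadd (Csum f l) (Csum g l).
Proof.
  induction l as [|x l IH]; cbn; [|fold (Csum (fun x => Cadd (f x) (g x)) l); rewrite IH];
    unfold Csum; ring.
Qed.

Lemma Csum_scal k (f : A -> Cplx) l :
  Csum (fun x => Cmul k (f x)) l = Cmul k (Csum f l).
Proof.
  induction l as [|x l IH]; cbn; [|fold (Csum (fun x => Cmul k (f x)) l); rewrite IH];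
    unfold Csum; ring.
Qed.

Lemma Csum_0 (f : A -> Cplx) l : (forall x, In x l -> f x = C0) -> Csum f l = C0.
Proof.
  induction l as [|x l IH]; cbn; intros H; auto.
  fold (Csum f l); rewrite H, IH by auto; ring.
Qed.

Lemma Csum_perm (f : A -> Cplx) l l' : Permutation l l' -> Csum f l = Csum f l'.
Proof.
  induction 1; cbn; auto; try congruence.
  - fold (Csum f l) (Csum f l'); congruence.
  - fold (Csum f l); ring.
Qed.

Lemma Csum_single (f : A -> Cplx) l x :
  NoDup l -> In x l -> (forall y, In y l -> y <> x -> f y = C0) ->
  Csum f l = f x.
Proof.
  intros Hn Hx H.
  destruct (in_split _ _ Hx) as (l1 & l2 & ->).
  rewrite (Csum_perm f _ (x :: l1 ++ l2)) by (symmetry; apply Permutation_middle).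
  cbn; fold (Csum f (l1 ++ l2)); rewrite Csum_0; [ring|].
  intros y Hy; apply H.
  - rewrite in_app_iff in *; cbn; tauto.
  - intros ->; exact (NoDup_remove_2 _ _ _ Hn Hy).
Qed.

Lemma Csum_filter (p : A -> bool) (f : A -> Cplx) l :
  Csum (fun x => if p x then f x else C0) l = Csum f (filter p l).
Proof.
  induction l as [|x l IH]; cbn; auto.
  fold (Csum (fun x => if p x then f x else C0) l); rewrite IH.
  destruct (p x); cbn; unfold Csum; ring.
Qed.

Lemma Csum_map {B} (h : A -> B) (f : B -> Cplx) l :
  Csum f (map h l) = Csum (fun x => f (h x)) l.
Proof. induction l as [|x l IH]; cbn; auto; unfold Csum in *; congruence. Qed.

Lemma Rsum_ext (f g : A -> R) l :
  (forall x, In x l -> f x = g x) -> Rsum f l = Rsum g l.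
Proof. induction l as [|x l IH]; cbn; intros H; auto; f_equal; auto. Qed.

Lemma Rsum_le (f g : A -> R) l :
  (forall x, In x l -> f x <= g x) -> Rsum f l <= Rsum g l.
Proof.
  induction l as [|x l IH]; cbn; intros H; [lra|].
  apply Rplus_le_compat; auto.
Qed.

Lemma Rsum_ge0 (f : A -> R) l : (forall x, In x l -> 0 <= f x) -> 0 <= Rsum f l.
Proof.
  induction l as [|x l IH]; cbn; intros H; [lra|].
  apply Rplus_le_le_0_compat; auto.
Qed.

Lemma Rsum_add (f g : A -> R) l :
  Rsum (fun x => f x + g x) l = Rsum f l + Rsum g l.
Proof.
  induction l as [|x l IH]; cbn; [|fold (Rsum (fun x => f x + g x) l); rewrite IH];
    unfold Rsum; ring.
Qed.

Lemma Rsum_scal k (f : A -> R) l : Rsum (fun x => k * f x) l = k * Rsum f l.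
Proof.
  induction l as [|x l IH]; cbn; [|fold (Rsum (fun x => k * f x) l); rewrite IH];
    unfold Rsum; ring.
Qed.

Lemma Rsum_const k l : Rsum (fun _ => k) l = INR (length l) * k.
Proof.
  induction l as [|x l IH]; [change (0 = INR 0 * k); rewrite INR_0; ring|].
  cbn [length]; rewrite S_INR; cbn; fold (Rsum (fun _ : A => k) l); rewrite IH; ring.
Qed.

Lemma Rsum_perm (f : A -> R) l l' : Permutation l l' -> Rsum f l = Rsum f l'.
Proof.
  induction 1; cbn; auto; try congruence.
  - fold (Rsum f l) (Rsum f l'); congruence.
  - fold (Rsum f l); ring.
Qed.

Lemma Rsum_app (f : A -> R) l l' : Rsum f (l ++ l') = Rsum f l + Rsum f l'.
Proof.
  induction l as [|x l IH]; cbn; [unfold Rsum; ring|].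
  fold (Rsum f (l ++ l')) (Rsum f l); rewrite IH; ring.
Qed.

Lemma Rsum_map {B} (h : A -> B) (f : B -> R) l :
  Rsum f (map h l) = Rsum (fun x => f (h x)) l.
Proof. induction l as [|x l IH]; cbn; auto; unfold Rsum in *; congruence. Qed.

(** As [l] has no repetitions, its members can be cancelled one by one against members of [l']; what
    remains of [l'] contributes nonnegative terms. The list [l'] itself may repeat. *)
Lemma Rsum_incl (f : A -> R) l l' :
  (forall x, 0 <= f x) -> NoDup l -> incl l l' -> Rsum f l <= Rsum f l'.
Proof.
  intros Hf; revert l'; induction l as [|x l IH]; intros l' Hn Hi.
  - apply Rsum_ge0; auto.
  - destruct (in_split x l' (Hi x (or_introl eq_refl))) as (l1 & l2 & ->).
    rewrite (Rsum_perm f (l1 ++ x :: l2) (x :: l1 ++ l2)) by (symmetry; apply Permutation_middle).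
    cbn; apply Rplus_le_compat_l, IH.
    + now inversion Hn.
    + intros y Hy; specialize (Hi y (or_intror Hy)).
      inversion Hn; subst.
      rewrite in_app_iff in *; cbn in Hi; destruct Hi as [|[->|]]; tauto.
Qed.

Lemma Rsum_member (f : A -> R) l x :
  (forall y, 0 <= f y) -> In x l -> f x <= Rsum f l.
Proof.
  intros Hf Hx.
  replace (f x) with (Rsum f [x]) by (cbn; ring).
  apply Rsum_incl; auto.
  - repeat constructor; auto.
  - intros y [<-|[]]; auto.
Qed.

Lemma Cnorm_Csum (f : A -> Cplx) l : Cnorm (Csum f l) <= Rsum (fun x => Cnorm (f x)) l.
Proof.
  induction l as [|x l IH]; cbn; [rewrite Cnorm_0; lra|].
  eapply Rle_trans; [apply Cnorm_add|]; apply Rplus_le_compat_l, IH.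
Qed.

End Sums.

Lemma Rsum_flat_map {A B} (h : A -> list B) (f : B -> R) l :
  Rsum f (flat_map h l) = Rsum (fun x => Rsum f (h x)) l.
Proof.
  induction l as [|x l IH]; [reflexivity|].
  cbn [flat_map]; rewrite Rsum_app, IH; reflexivity.
Qed.

Lemma Rsum_swap {A B} (f : A -> B -> R) l l' :
  Rsum (fun x => Rsum (f x) l') l = Rsum (fun y => Rsum (fun x => f x y) l) l'.
Proof.
  induction l as [|x l IH]; cbn.
  - symmetry; rewrite Rsum_const; ring.
  - fold (Rsum (fun x => Rsum (f x) l') l); rewrite IH, <- Rsum_add; reflexivity.
Qed.

(** The map [g] reads off from an element the block it came from, so distinct blocks are disjoint.
    It is applied with the head of a list and with the sum of a pair of multi-indices. *)
Lemma NoDup_flat_map_retract {A B} (h : A -> list B) (g : B -> A) l :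
  NoDup l -> (forall x, In x l -> NoDup (h x)) ->
  (forall x y, In y (h x) -> g y = x) -> NoDup (flat_map h l).
Proof.
  induction 1 as [|x l Hx Hl IH]; cbn; intros Hh Hg; [constructor|].
  apply NoDup_app; auto.
  intros y Hy Hy'; apply in_flat_map in Hy' as (x' & Hx' & Hy').
  apply Hg in Hy, Hy'; congruence.
Qed.

(** * Multi-indices *)

Lemma total_cons x a : total (x :: a) = (x + total a)%nat.
Proof. reflexivity. Qed.

Lemma is_zero_total a : is_zero_idx a = true <-> total a = 0%nat.
Proof.
  induction a as [|x a IH]; [cbn; tauto|].
  rewrite total_cons; cbn [is_zero_idx forallb]; fold (is_zero_idx a).
  rewrite Bool.andb_true_iff, IH, Nat.eqb_eq; lia.
Qed.

Lemma is_zero_total_false a : is_zero_idx a = false <-> (0 < total a)%nat.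
Proof.
  rewrite <- Bool.not_true_iff_false, is_zero_total; lia.
Qed.

Lemma total_zero_idx n : total (zero_idx n) = 0%nat.
Proof. induction n as [|n IH]; cbn; auto. Qed.

Lemma total0_zero_idx a : total a = 0%nat -> a = zero_idx (length a).
Proof.
  induction a as [|x a IH]; auto.
  rewrite total_cons; intros H; cbn; unfold zero_idx in IH; rewrite <- IH by lia.
  f_equal; lia.
Qed.

Lemma in_comps n d g : In g (comps n d) <-> length g = n /\ (total g <= d)%nat.
Proof.
  revert d g; induction n as [|n IH]; intros d g.
  - cbn; destruct g; cbn; split; intuition (try congruence; try lia).
  - cbn [comps]; rewrite in_flat_map; split.
    + intros (i & Hi & Hg); apply in_seq in Hi; apply in_map_iff in Hg as (g' & <- & Hg).
      apply IH in Hg as [? ?]; rewrite total_cons; cbn; lia.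
    + destruct g as [|i g]; cbn [length]; rewrite ?total_cons; [lia|].
      intros [? ?]; exists i; split; [apply in_seq; lia|].
      apply in_map, IH; lia.
Qed.

Lemma NoDup_map_cons (i : nat) l : NoDup l -> NoDup (map (cons i) l).
Proof.
  apply FinFun.Injective_map_NoDup; intros x y H; congruence.
Qed.

Lemma NoDup_comps n d : NoDup (comps n d).
Proof.
  revert d; induction n as [|n IH]; intros d; cbn [comps].
  - repeat constructor; auto.
  - apply (NoDup_flat_map_retract _ (hd 0%nat)); auto using seq_NoDup, NoDup_map_cons.
    intros x y Hy; apply in_map_iff in Hy as (? & <- & _); reflexivity.
Qed.

Lemma NoDup_below a : NoDup (below a).
Proof.
  induction a as [|x a IH]; cbn [below].
  - repeat constructor; auto.
  - apply (NoDup_flat_map_retract _ (hd 0%nat)); auto using seq_NoDup, NoDup_map_cons.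
    intros i y Hy; apply in_map_iff in Hy as (? & <- & _); reflexivity.
Qed.

Lemma in_below_cons y b x a :
  In (y :: b) (below (x :: a)) <-> (y <= x)%nat /\ In b (below a).
Proof.
  cbn [below]; rewrite in_flat_map; split.
  - intros (i & Hi & Hg); apply in_seq in Hi; apply in_map_iff in Hg as (g' & E & Hg).
    injection E as <- <-; split; [lia|auto].
  - intros [? ?]; exists y; split; [apply in_seq; lia|now apply in_map].
Qed.

(** Simultaneous induction on both indices; the cases of unequal length cannot occur for members of
    [below a]. *)
Lemma in_below_ind (P : midx -> midx -> Prop) :
  P [] [] ->
  (forall x y a b, (y <= x)%nat -> In b (below a) -> P a b -> P (x :: a) (y :: b)) ->
  forall a b, In b (below a) -> P a b.
Proof.
  intros H0 Hc; induction a as [|x a IH]; intros b Hb.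
  - destruct Hb as [<-|[]]; auto.
  - destruct b as [|y b].
    + cbn [below] in Hb; apply in_flat_map in Hb as (i & _ & Hb).
      apply in_map_iff in Hb as (? & ? & _); discriminate.
    + apply in_below_cons in Hb as [? ?]; auto.
Qed.

Lemma below_length a b : In b (below a) -> length b = length a.
Proof. revert a b; apply in_below_ind; cbn; auto. Qed.

Lemma idx_sub_length a b : In b (below a) -> length (idx_sub a b) = length a.
Proof. revert a b; apply in_below_ind; cbn; auto. Qed.

Lemma idx_sub_total a b :
  In b (below a) -> (total b + total (idx_sub a b) = total a)%nat.
Proof.
  revert a b; apply in_below_ind; auto.
  intros; cbn [idx_sub]; rewrite !total_cons; lia.
Qed.

(** Recovers [a] from the pair [(b, idx_sub a b)]. This is what makes the pairs in a Cauchy product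
    distinct. *)
Fixpoint idx_add (a b : midx) : midx :=
  match a, b with
  | x :: a', y :: b' => (x + y)%nat :: idx_add a' b'
  | _, _ => a
  end.

Lemma idx_subK a b : In b (below a) -> idx_add b (idx_sub a b) = a.
Proof.
  revert a b; apply in_below_ind; auto.
  intros; cbn; f_equal; auto; lia.
Qed.

Lemma in_below_refl a : In a (below a).
Proof. induction a; [cbn; auto|apply in_below_cons; auto]. Qed.

Lemma in_below_zero a : In (zero_idx (length a)) (below a).
Proof. induction a; [cbn; auto|apply in_below_cons; split; [lia|auto]]. Qed.

Lemma idx_sub_zero a : idx_sub a (zero_idx (length a)) = a.
Proof. induction a as [|x a IH]; cbn; auto; f_equal; [lia|exact IH]. Qed.

Lemma idx_sub_self_total a b :
  In b (below a) -> total (idx_sub a b) = 0%nat -> b = a.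
Proof.
  revert a b; apply (in_below_ind (fun a b => total (idx_sub a b) = 0%nat -> b = a)); auto.
  intros x y a b Hy _ IH; cbn [idx_sub]; rewrite total_cons; intros H.
  f_equal; [lia|apply IH; lia].
Qed.

(** * Formal power series *)

Lemma ps_one_total0 a : total a = 0%nat -> ps_one a = C1.
Proof. intros H; unfold ps_one; now rewrite (proj2 (is_zero_total a) H). Qed.

Lemma ps_one_pos a : (0 < total a)%nat -> ps_one a = C0.
Proof. intros H; unfold ps_one; now rewrite (proj2 (is_zero_total_false a) H). Qed.

Lemma ps_mul_one f : ps_mul f ps_one = f.
Proof.
  apply functional_extensionality; intros a; unfold ps_mul.
  rewrite (Csum_single _ _ a); auto using NoDup_below, in_below_refl.
  - pose proof (idx_sub_total a a (in_below_refl a)).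
    rewrite ps_one_total0 by lia; ring.
  - intros b Hb Hn; rewrite ps_one_pos; [ring|].
    destruct (Nat.eq_dec (total (idx_sub a b)) 0) as [E|]; [|lia].
    now apply idx_sub_self_total in E.
Qed.

Lemma ps_one_mul f : ps_mul ps_one f = f.
Proof.
  apply functional_extensionality; intros a; unfold ps_mul.
  rewrite (Csum_single _ _ (zero_idx (length a))); auto using NoDup_below, in_below_zero.
  - rewrite idx_sub_zero, ps_one_total0 by apply total_zero_idx; ring.
  - intros b Hb Hn; rewrite ps_one_pos; [ring|].
    destruct (Nat.eq_dec (total b) 0) as [E|]; [|lia].
    apply total0_zero_idx in E; rewrite (below_length a b Hb) in E; congruence.
Qed.

(** * Monomials of degree at most one in the unknown series *)

Lemma ps_prod_pows_zero z i n : ps_prod_pows z i (zero_idx n) = ps_one.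
Proof.
  revert i; induction n as [|n IH]; intros i; cbn; auto.
  unfold zero_idx in IH; now rewrite IH, ps_mul_one.
Qed.

(** Generalizes [unit_idx] to an arbitrary start index, as needed for induction on the length;
    [unit_idx n k] is [unit_from k 0 n]. *)
Definition unit_from (k i n : nat) : midx :=
  map (fun x => if Nat.eqb x k then 1%nat else 0%nat) (seq i n).

Lemma ps_prod_pows_unit_from z k i n :
  ps_prod_pows z i (unit_from k i n) =
  if ((i <=? k)%nat && (k <? i + n)%nat)%bool then z k else ps_one.
Proof.
  revert i; induction n as [|n IH]; intros i.
  - destruct (Nat.leb_spec i k), (Nat.ltb_spec k (i + 0)); try reflexivity; lia.
  - unfold unit_from in *; cbn [seq map ps_prod_pows]; rewrite IH.
    destruct (Nat.eqb_spec i k), (Nat.leb_spec i k), (Nat.ltb_spec k (i + S n)),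
      (Nat.leb_spec (S i) k), (Nat.ltb_spec k (S i + n)); cbn; subst;
      rewrite ?ps_mul_one, ?ps_one_mul; auto; lia.
Qed.

Lemma ps_prod_pows_unit z n k : (k < n)%nat -> ps_prod_pows z 0 (unit_idx n k) = z k.
Proof.
  intros H; change (unit_idx n k) with (unit_from k 0 n); rewrite ps_prod_pows_unit_from.
  destruct (Nat.ltb_spec k (0 + n)); [reflexivity|lia].
Qed.

Lemma total_unit_from k i n :
  total (unit_from k i n) = if ((i <=? k)%nat && (k <? i + n)%nat)%bool then 1%nat else 0%nat.
Proof.
  revert i; induction n as [|n IH]; intros i.
  - destruct (Nat.leb_spec i k), (Nat.ltb_spec k (i + 0)); try reflexivity; lia.
  - unfold unit_from in *; cbn [seq map]; rewrite total_cons, IH.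
    destruct (Nat.eqb_spec i k), (Nat.leb_spec i k), (Nat.ltb_spec k (i + S n)),
      (Nat.leb_spec (S i) k), (Nat.ltb_spec k (S i + n)); cbn; lia.
Qed.

Lemma total1_unit_from g i :
  total g = 1%nat -> exists k, (i <= k < i + length g)%nat /\ g = unit_from k i (length g).
Proof.
  revert i; induction g as [|x g IH]; intros i; [discriminate|].
  rewrite total_cons; intros H; destruct x as [|x].
  - destruct (IH (S i)) as (k & Hk & E); [lia|].
    exists k; split; [cbn; lia|].
    unfold unit_from in *; cbn [length seq map].
    destruct (Nat.eqb_spec i k); [lia|congruence].
  - exists i; split; [cbn; lia|].
    assert (Hg : total g = 0%nat) by lia.
    unfold unit_from; cbn [length seq map]; rewrite Nat.eqb_refl; f_equal; [lia|].
    rewrite (total0_zero_idx g Hg) at 1.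
    (* The start of the [seq] is generalized to some [s] while keeping [S i <= s], so the position
       [i] is never met and the tail stays zero. *)
    generalize (Nat.le_refl (S i)); generalize (S i) at 2 3; generalize (length g).
    intros n; induction n as [|n IHn]; intros s Hs; cbn; auto.
    destruct (Nat.eqb_spec s i); [lia|]; f_equal; apply IHn; lia.
Qed.

Lemma unit_idx_inj n k k' :
  (k < n)%nat -> unit_idx n k = unit_idx n k' -> k = k'.
Proof.
  intros Hk E.
  apply (f_equal (fun l => nth_error l k)) in E; unfold unit_idx in E.
  rewrite !nth_error_map, nth_error_seq, (proj2 (Nat.ltb_lt k n) Hk) in E.
  cbn in E; rewrite Nat.eqb_refl in E.
  destruct (Nat.eqb_spec k k'); [auto|discriminate].
Qed.

(** Identifies the exponents that produce the constant and the linear terms, turning a sum over them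
    into one constant term and a sum over coordinates. The bound [1 <= d] guarantees that the unit
    indices are listed. *)
Lemma comps_linear_perm n d : (1 <= d)%nat ->
  Permutation (filter (fun g => total g <=? 1)%nat (comps n d))
    (zero_idx n :: map (unit_idx n) (seq 0 n)).
Proof.
  intros Hd; apply NoDup_Permutation.
  - apply NoDup_filter, NoDup_comps.
  - constructor.
    + intros H; apply in_map_iff in H as (k & E & Hk); apply in_seq in Hk.
      pose proof (total_unit_from k 0 n) as T.
      change (unit_from k 0 n) with (unit_idx n k) in T.
      rewrite E, total_zero_idx in T.
      destruct (Nat.ltb_spec k (0 + n)); [discriminate|lia].
    + apply FinFun.Injective_map_NoDup_in; [|apply seq_NoDup].
      intros k k' Hk _; apply in_seq in Hk; apply unit_idx_inj; lia.
  - intros g; rewrite filter_In, in_comps, Nat.leb_le; cbn [In].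
    rewrite in_map_iff; split.
    + intros [[Hl _] Ht].
      assert (total g = 0 \/ total g = 1)%nat as [E|E] by lia.
      * left; apply total0_zero_idx in E; congruence.
      * right; destruct (total1_unit_from g 0 E) as (k & Hk & Eg).
        exists k; rewrite in_seq; rewrite Hl in *; split; [now rewrite Eg|lia].
    + intros [<-|(k & <- & Hk)].
      * rewrite total_zero_idx; unfold zero_idx; rewrite repeat_length; lia.
      * pose proof (total_unit_from k 0 n) as T.
        change (unit_from k 0 n) with (unit_idx n k) in T.
        assert (total (unit_idx n k) <= 1)%nat by (rewrite T; now destruct (_ && _)%bool; auto).
        split; [split|]; try lia.
        unfold unit_idx; now rewrite length_map, length_seq.
Qed.

(** Taylor coefficients of [H_j(t, Y + z) - H_j(0, Y) - (D z)_j]: every surviving term carries a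
    factor from [t] or at least two factors from [z]. *)
Definition nonlin (c : midx -> midx -> Cplx) (b g : midx) : Cplx :=
  if (is_zero_idx b && (total g <=? 1)%nat)%bool then C0 else c b g.

(** The discarded terms all have [b] zero. Among them the constant one is multiplied by [ps_one a],
    which vanishes in positive degree, and the unit exponents give the Jacobian row applied to the
    coefficients [z k a]. *)
Lemma comp_coef_split m n c z a :
  length a = m -> (0 < total a)%nat ->
  comp_coef n c z a =
  Cadd (Csum (fun k => Cmul (c (zero_idx m) (unit_idx n k)) (z k a)) (seq 0 n))
       (comp_coef n (nonlin c) z a).
Proof.
  intros Hl Ha; subst m; unfold comp_coef at 1.
  set (T b g := Cmul (c b g) (ps_prod_pows z 0 g (idx_sub a b))).
  set (lin b g := (is_zero_idx b && (total g <=? 1)%nat)%bool).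
  rewrite (Csum_ext _ (fun b => Cadd
     (Csum (fun g => if lin b g then T b g else C0) (comps n (total a)))
     (Csum (fun g => Cmul (nonlin c b g) (ps_prod_pows z 0 g (idx_sub a b))) (comps n (total a))))).
  2: { intros b _; rewrite <- Csum_add; apply Csum_ext; intros g _.
       unfold T, nonlin; fold (lin b g); destruct (lin b g); ring. }
  rewrite Csum_add; fold (comp_coef n (nonlin c) z a); f_equal.
  rewrite (Csum_single _ _ (zero_idx (length a))); auto using NoDup_below, in_below_zero.
  - unfold lin; rewrite (proj2 (is_zero_total (zero_idx (length a)))) by apply total_zero_idx.
    cbn [andb]; rewrite Csum_filter, (Csum_perm _ _ _ (comps_linear_perm n (total a) Ha)).
    cbn [Csum fold_right]; fold (Csum (T (zero_idx (length a))) (map (unit_idx n) (seq 0 n))).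
    rewrite Csum_map.
    unfold T at 1; rewrite ps_prod_pows_zero, idx_sub_zero, (ps_one_pos a Ha).
    rewrite (Csum_ext _ (fun k => Cmul (c (zero_idx (length a)) (unit_idx n k)) (z k a))); [ring|].
    intros k Hk; apply in_seq in Hk; unfold T.
    rewrite ps_prod_pows_unit, idx_sub_zero by lia; reflexivity.
  - intros b Hb Hn; apply Csum_0; intros g _; unfold lin.
    destruct (is_zero_idx b) eqn:E; [|reflexivity].
    apply is_zero_total, total0_zero_idx in E; rewrite (below_length a b Hb) in E; congruence.
Qed.

(* The multiplicative bookkeeping behind the recursion: a product of [p] series without
   constant term that are known up to order [k] is known up to order [k + p - 1]. *)
Definition agree (m k p : nat) (f f' : ps) : Prop :=
  forall a, length a = m ->
    ((total a < p)%nat -> f a = C0 /\ f' a = C0) /\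
    ((total a < k + Nat.max p 1)%nat -> f a = f' a).

Lemma agree_one m k : agree m k 0 ps_one ps_one.
Proof. intros a _; split; [lia|auto]. Qed.

(** In a product term that survives, each factor has at least its prescribed order. Its degree is
    then at most the total degree minus the order of the other factor, which lies below its own
    cutoff. The [Nat.max] covers factors of order 0, known only up to degree [k]. *)
Lemma agree_mul m k p s f f' g g' :
  agree m k p f f' -> agree m k s g g' -> agree m k (p + s) (ps_mul f g) (ps_mul f' g').
Proof.
  intros Hf Hg a Ha; unfold ps_mul; split; intros Ht.
  - split; apply Csum_0; intros b Hb;
      pose proof (below_length a b Hb); pose proof (idx_sub_length a b Hb);
      pose proof (idx_sub_total a b Hb);
      destruct (Hf b ltac:(congruence)) as [Hf0 _];
      destruct (Hg (idx_sub a b) ltac:(congruence)) as [Hg0 _];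
      (assert (total b < p \/ total (idx_sub a b) < s)%nat as [C|C] by lia;
       [destruct (Hf0 C) as [E E']|destruct (Hg0 C) as [E E']]); rewrite ?E, ?E'; ring.
  - apply Csum_ext; intros b Hb.
    pose proof (below_length a b Hb); pose proof (idx_sub_length a b Hb).
    pose proof (idx_sub_total a b Hb).
    destruct (Hf b ltac:(congruence)) as [Hf0 Hf1].
    destruct (Hg (idx_sub a b) ltac:(congruence)) as [Hg0 Hg1].
    destruct (Nat.lt_ge_cases (total b) p) as [C|C];
      [destruct (Hf0 C) as [-> ->]; ring|].
    destruct (Nat.lt_ge_cases (total (idx_sub a b)) s) as [C'|C'];
      [destruct (Hg0 C') as [-> ->]; ring|].
    rewrite Hf1, Hg1 by lia; reflexivity.
Qed.

Lemma agree_pow m k f f' x : agree m k 1 f f' -> agree m k x (ps_pow f x) (ps_pow f' x).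
Proof.
  intros H; induction x as [|x IH]; [apply agree_one|].
  exact (agree_mul _ _ 1 x _ _ _ _ H IH).
Qed.

Lemma agree_prod_pows m k z z' i g :
  (forall j, (i <= j < i + length g)%nat -> agree m k 1 (z j) (z' j)) ->
  agree m k (total g) (ps_prod_pows z i g) (ps_prod_pows z' i g).
Proof.
  revert i; induction g as [|x g IH]; intros i H; [apply agree_one|].
  rewrite total_cons; cbn [ps_prod_pows length] in *; apply agree_mul.
  - apply agree_pow, H; lia.
  - apply IH; intros j Hj; apply H; lia.
Qed.

(** This gains one degree: knowing [z] through degree [k] fixes the nonlinear part through degree
    [k + 1]. Either [b] is nonzero and lowers the degree left for the product, or the product has at
    least two factors and is known one degree further. *)
Lemma comp_coef_nonlin_agree m n k c z z' a :
  length a = m -> (total a <= S k)%nat ->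
  (forall i, (i < n)%nat -> agree m k 1 (z i) (z' i)) ->
  comp_coef n (nonlin c) z a = comp_coef n (nonlin c) z' a.
Proof.
  intros Hl Ha Hz; unfold comp_coef.
  apply Csum_ext; intros b Hb; apply Csum_ext; intros g Hg.
  apply in_comps in Hg as [Hg _].
  pose proof (idx_sub_length a b Hb); pose proof (idx_sub_total a b Hb).
  unfold nonlin; destruct (is_zero_idx b && (total g <=? 1)%nat)%bool eqn:E; [ring|].
  f_equal; refine (proj2 (agree_prod_pows m k z z' 0 g _ (idx_sub a b) _) _); [|congruence|].
  - intros j Hj; apply Hz; lia.
  - apply Bool.andb_false_iff in E as [E|E].
    + apply is_zero_total_false in E; lia.
    + apply Nat.leb_gt in E; lia.
Qed.

(** * Coefficients at the zero multi-index *)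

Lemma below_zero m : below (zero_idx m) = [zero_idx m].
Proof.
  induction m as [|m IH]; [reflexivity|].
  cbn; unfold zero_idx in IH; rewrite IH; reflexivity.
Qed.

Lemma comps_zero n : comps n 0 = [zero_idx n].
Proof.
  induction n as [|n IH]; [reflexivity|].
  cbn; rewrite IH; reflexivity.
Qed.

Lemma comp_coef_zero m n c z :
  comp_coef n c z (zero_idx m) = c (zero_idx m) (zero_idx n).
Proof.
  unfold comp_coef; rewrite below_zero, total_zero_idx, comps_zero; cbn [Csum fold_right].
  rewrite ps_prod_pows_zero.
  replace (idx_sub (zero_idx m) (zero_idx m)) with (zero_idx m).
  - rewrite ps_one_total0 by apply total_zero_idx; ring.
  - pose proof (idx_sub_zero (zero_idx m)) as H.
    unfold zero_idx in *; rewrite repeat_length in H; congruence.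
Qed.

Lemma qpow_zero q m : qpow q (zero_idx m) = C1.
Proof.
  unfold qpow; generalize 0%nat; induction m as [|m IH]; intros i; [reflexivity|].
  cbn; unfold zero_idx in IH; rewrite IH; ring.
Qed.

(** * Linear systems and the formal solution *)

(** Gaussian elimination, by induction on the number of equations: a nonzero entry of the first row
    serves as pivot and removes one equation and one unknown. This avoids determinants
    altogether. *)
Lemma homogeneous_solution (rows : list (nat -> Cplx)) (L : list nat) :
  NoDup L -> (length rows < length L)%nat ->
  exists v, (exists k, In k L /\ v k <> C0) /\
    forall r, In r rows -> Csum (fun k => Cmul (r k) (v k)) L = C0.
Proof.
  remember (length rows) as s eqn:Es.
  revert rows Es L; induction s as [|s IH]; intros rows Es L HL Hlen.
  - destruct rows; [|discriminate].
    destruct L as [|k L]; [cbn in Hlen; lia|].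
    exists (fun _ => C1); split; [|intros r []].
    exists k; split; [now left|]; intros E; injection E; lra.
  - destruct rows as [|row rows]; [discriminate|]; injection Es as Es.
    destruct (classic (exists p, In p L /\ row p <> C0)) as [(p & Hp & Hrow)|Hno].
    + destruct (Cinv_exists _ Hrow) as [u Hu].
      destruct (in_split _ _ Hp) as (l1 & l2 & ->).
      set (L' := l1 ++ l2).
      assert (HL' : NoDup L') by exact (NoDup_remove_1 _ _ _ HL).
      assert (Hp' : ~ In p L') by exact (NoDup_remove_2 _ _ _ HL).
      set (red := fun (r : nat -> Cplx) k => Csub (r k) (Cmul (Cmul (r p) u) (row k))).
      destruct (IH (map red rows)) with (L := L') as (v & (k0 & Hk0 & Hv0) & Hv); auto.
      { now rewrite length_map. }
      { unfold L'; rewrite !length_app in *; cbn in Hlen; lia. }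
      set (S := Csum (fun k => Cmul (row k) (v k)) L').
      (* Back substitution: since [u] inverts [row p], this value of the pivot unknown makes the
         pivot row vanish. *)
      set (w k := if Nat.eqb k p then Copp (Cmul u S) else v k).
      assert (Hw : forall r, Csum (fun k => Cmul (r k) (w k)) (l1 ++ p :: l2) =
        Csub (Csum (fun k => Cmul (r k) (v k)) L') (Cmul (Cmul (r p) u) S)).
      { intros r.
        rewrite (Csum_perm _ (l1 ++ p :: l2) (p :: L')) by
          (symmetry; apply Permutation_middle).
        cbn [Csum fold_right]; fold (Csum (fun k => Cmul (r k) (w k)) L').
        rewrite (Csum_ext (fun k => Cmul (r k) (w k)) (fun k => Cmul (r k) (v k)) L').
        - unfold w; rewrite Nat.eqb_refl; ring.
        - intros k Hk; unfold w; destruct (Nat.eqb_spec k p); [congruence|auto]. }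
      exists w; split.
      * exists k0; split; [unfold L' in Hk0; rewrite in_app_iff in *; cbn; tauto|].
        unfold w; destruct (Nat.eqb_spec k0 p); [congruence|auto].
      * intros r [<-|Hr]; rewrite Hw.
        -- rewrite Hu; fold S; ring.
        -- rewrite <- (Hv (red r)) by now apply in_map.
           rewrite (Csum_ext (fun k => Cmul (red r k) (v k)) (fun k => Cadd (Cmul (r k) (v k))
             (Cmul (Copp (Cmul (r p) u)) (Cmul (row k) (v k))))) by (intros; unfold red; ring).
           rewrite Csum_add, Csum_scal; fold S; ring.
    (* Without a pivot the first row is zero on [L], so that equation holds for every vector. *)
    + destruct (IH rows Es L) as (v & Hv0 & Hv); auto; [lia|].
      exists v; split; auto; intros r [<-|Hr]; auto.
      apply Csum_0; intros k Hk.
      destruct (classic (row k = C0)) as [->|]; [ring|].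
      exfalso; eauto.
Qed.

Lemma noneigenvalue_injective n D x w :
  ~ is_eigenvalue n D x ->
  (forall j, (j < n)%nat -> Csum (fun k => Cmul (D j k) (w k)) (seq 0 n) = Cmul x (w j)) ->
  forall k, (k < n)%nat -> w k = C0.
Proof.
  intros Hx Hw k Hk; apply NNPP; intros Hne; apply Hx.
  exists w; split; eauto.
Qed.

(** With [r] as an additional column there are [n] homogeneous equations in [n + 1] unknowns, hence
    a nontrivial solution. Its last coordinate is nonzero, since otherwise the others would form an
    eigenvector; dividing by it solves the inhomogeneous system. *)
Lemma noneigenvalue_surjective n D x (r : nat -> Cplx) :
  ~ is_eigenvalue n D x ->
  exists v, forall j, (j < n)%nat ->
    Cmul x (v j) = Cadd (Csum (fun k => Cmul (D j k) (v k)) (seq 0 n)) (r j).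
Proof.
  intros Hx.
  (* the last unknown is a homogenizing variable *)
  set (row j k := if Nat.eqb k n then r j
                  else Csub (D j k) (if Nat.eqb k j then x else C0)).
  destruct (homogeneous_solution (map row (seq 0 n)) (seq 0 (S n)))
    as (v & (k0 & Hk0 & Hv0) & Hv).
  { apply seq_NoDup. }
  { rewrite length_map, !length_seq; lia. }
  assert (H : forall j, (j < n)%nat ->
    Cmul x (v j) = Cadd (Csum (fun k => Cmul (D j k) (v k)) (seq 0 n)) (Cmul (r j) (v n))).
  { intros j Hj.
    specialize (Hv (row j) (in_map row _ _ (proj2 (in_seq n 0 j) ltac:(lia)))).
    rewrite seq_S in Hv; cbn [Nat.add] in Hv.
    rewrite (Csum_perm _ (seq 0 n ++ [n]) (n :: seq 0 n)) in Hv by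
      (symmetry; apply Permutation_cons_append).
    cbn [Csum fold_right] in Hv; fold (Csum (fun k => Cmul (row j k) (v k)) (seq 0 n)) in Hv.
    rewrite (Csum_ext _ (fun k => Cadd (Cmul (D j k) (v k))
      (Cmul (Copp C1) (if Nat.eqb k j then Cmul x (v k) else C0)))) in Hv.
    - rewrite Csum_add, Csum_scal, (Csum_single (fun k => if Nat.eqb k j then _ else _) _ j) in Hv.
      + rewrite Nat.eqb_refl in Hv; unfold row in Hv; rewrite Nat.eqb_refl in Hv.
        symmetry; apply Csub_eq0.
        etransitivity; [|exact Hv]; ring.
      + apply seq_NoDup.
      + apply in_seq; lia.
      + intros y _ Hy; destruct (Nat.eqb_spec y j); [congruence|reflexivity].
    - intros k Hk; apply in_seq in Hk; unfold row.
      destruct (Nat.eqb_spec k n); [lia|]; destruct (Nat.eqb_spec k j); ring. }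
  destruct (classic (v n = C0)) as [E|E].
  - exfalso; apply Hv0; apply in_seq in Hk0.
    destruct (Nat.eq_dec k0 n) as [->|]; [exact E|].
    apply (noneigenvalue_injective n D x v Hx); [|lia].
    intros j Hj; rewrite (H j Hj), E; ring.
  - destruct (Cinv_exists _ E) as [u Hu].
    exists (fun k => Cmul u (v k)); intros j Hj.
    rewrite (Csum_ext _ (fun k => Cmul u (Cmul (D j k) (v k)))) by (intros; cbv beta; ring).
    rewrite Csum_scal.
    replace (Cmul x (Cmul u (v j))) with (Cmul u (Cmul x (v j))) by ring.
    rewrite (H j Hj).
    replace (r j) with (Cmul (r j) (Cmul (v n) u)) at 2 by (rewrite Hu; ring); ring.
Qed.

(** At the zero index the functional equation is just the fixed-point condition on [Y]. In positive
    degree, [shift_series y] and [y] have the same coefficients, and the linear part splits off. *)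
Lemma solution_recursion m n q Y c y :
  (forall j, (j < n)%nat -> c j (zero_idx m) (zero_idx n) = Y j) ->
  is_solution m n q Y c y <->
  (forall j, (j < n)%nat -> y j (zero_idx m) = Y j) /\
  (forall j a, (j < n)%nat -> length a = m -> (0 < total a)%nat ->
     Cmul (qpow q a) (y j a) =
     Cadd (Csum (fun k => Cmul (jacobian m n c j k) (y k a)) (seq 0 n))
          (comp_coef n (nonlin (c j)) (shift_series y) a)).
Proof.
  intros Hfix.
  assert (H : forall j a, length a = m -> (0 < total a)%nat ->
    comp_coef n (c j) (shift_series y) a =
     Cadd (Csum (fun k => Cmul (jacobian m n c j k) (y k a)) (seq 0 n))
          (comp_coef n (nonlin (c j)) (shift_series y) a)).
  { intros j a Hl Ha; rewrite (comp_coef_split m) by auto; f_equal.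
    apply Csum_ext; intros k _; unfold shift_series.
    now rewrite (proj2 (is_zero_total_false a) Ha). }
  split; intros [H0 Hs]; split; auto.
  - intros j a Hj Hl Ha; rewrite <- H; auto.
  - intros j a Hj Hl.
    destruct (Nat.eq_dec (total a) 0) as [E|E].
    + apply total0_zero_idx in E; rewrite Hl in E; subst a.
      rewrite qpow_zero, comp_coef_zero, H0, Hfix by auto; ring.
    + rewrite H by (auto; lia); apply Hs; auto; lia.
Qed.

Lemma shift_series_agree m k (y y' : nat -> ps) i :
  (forall a, length a = m -> (total a <= k)%nat -> y i a = y' i a) ->
  agree m k 1 (shift_series y i) (shift_series y' i).
Proof.
  intros H a Hl; unfold shift_series; split; intros Ht.
  - now rewrite (proj2 (is_zero_total a)) by lia.
  - destruct (is_zero_idx a); auto; apply H; auto; lia.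
Qed.

Lemma noneigenvalue_qpow m n q D a :
  (forall lam, is_eigenvalue n D lam -> ~ in_Q m q lam) ->
  length a = m -> (0 < total a)%nat -> ~ is_eigenvalue n D (qpow q a).
Proof.
  intros H Hl Ha He; apply (H _ He); exists a; repeat split; auto.
  now apply is_zero_total_false.
Qed.

(** Induction on the total degree: the nonlinear parts at [a] agree by the induction hypothesis, so
    the difference of the two coefficient vectors lies in the kernel of [q^a - D]. *)
Lemma solution_unique m n q Y c y y' :
  (forall j, (j < n)%nat -> c j (zero_idx m) (zero_idx n) = Y j) ->
  (forall lam, is_eigenvalue n (jacobian m n c) lam -> ~ in_Q m q lam) ->
  is_solution m n q Y c y -> is_solution m n q Y c y' ->
  forall j a, (j < n)%nat -> length a = m -> y' j a = y j a.
Proof.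
  intros Hfix Hres Hy Hy'.
  apply (solution_recursion m n q Y c _ Hfix) in Hy as [H0 Hs], Hy' as [H0' Hs'].
  enough (H : forall k a, (total a <= k)%nat -> length a = m ->
    forall j, (j < n)%nat -> y' j a = y j a) by eauto.
  intros k; induction k as [|k IH]; intros a Ha Hl.
  - intros j Hj; rewrite (total0_zero_idx a) by lia; rewrite Hl, H0, H0'; auto.
  - destruct (Nat.le_gt_cases (total a) k) as [|Hk]; [now apply IH|].
    intros j Hj; apply Csub_eq0.
    apply (noneigenvalue_injective n (jacobian m n c) (qpow q a)
      (fun j => Csub (y' j a) (y j a))); auto.
    { apply (noneigenvalue_qpow m); auto; lia. }
    clear j Hj; intros j Hj.
    replace (Cmul (qpow q a) (Csub (y' j a) (y j a))) with
      (Csub (Cmul (qpow q a) (y' j a)) (Cmul (qpow q a) (y j a))) by ring.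
    rewrite Hs, Hs' by (auto; lia).
    rewrite (comp_coef_nonlin_agree m n k (c j) (shift_series y') (shift_series y)); auto.
    + rewrite (Csum_ext _ (fun k => Cadd (Cmul (jacobian m n c j k) (y' k a))
        (Cmul (Copp C1) (Cmul (jacobian m n c j k) (y k a))))) by (intros; cbv beta; ring).
      rewrite Csum_add, Csum_scal; ring.
    + intros i Hi; apply shift_series_agree; auto.
Qed.

Lemma solution_exists m n q Y c :
  (forall j, (j < n)%nat -> c j (zero_idx m) (zero_idx n) = Y j) ->
  (forall lam, is_eigenvalue n (jacobian m n c) lam -> ~ in_Q m q lam) ->
  exists y, is_solution m n q Y c y.
Proof.
  intros Hfix Hres.
  set (spec (y : nat -> ps) a (v : nat -> Cplx) := forall j, (j < n)%nat ->
     Cmul (qpow q a) (v j) =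
     Cadd (Csum (fun k => Cmul (jacobian m n c j k) (v k)) (seq 0 n))
          (comp_coef n (nonlin (c j)) (shift_series y) a)).
  (* Chooses a coefficient vector at [a] that solves the linear system whose right-hand side comes
     from [y]; solvability is checked only where the choice is used. *)
  set (step y a := epsilon (inhabits (fun _ : nat => C0)) (spec y a)).
  (* Stage [k] is final on degrees at most [k]; its values in higher degrees are provisional and are
     replaced at later stages. The solution [y] reads each coefficient at the stage equal to its
     degree. *)
  set (approx := fix approx k : nat -> ps := match k with
     | O => fun j _ => Y j
     | S k' => fun j a => if (total a <=? k')%nat then approx k' j a
                          else step (approx k') a j
     end).
  set (y j a := approx (total a) j a).
  assert (Happ : forall k j a, (total a <= k)%nat -> approx k j a = y j a).
  { induction k as [|k IH]; intros j a Ha; unfold y.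
    - now replace (total a) with 0%nat by lia.
    - destruct (Nat.eq_dec (total a) (S k)) as [->|]; [reflexivity|].
      cbn; rewrite (proj2 (Nat.leb_le _ _)) by lia; apply IH; lia. }
  exists y; apply solution_recursion; auto; split.
  - intros j Hj; unfold y; now rewrite total_zero_idx.
  - intros j a Hj Hl Ha.
    destruct (total a) as [|k] eqn:Ek; [lia|].
    assert (Hst : spec (approx k) a (step (approx k) a)).
    { apply epsilon_spec; apply noneigenvalue_surjective.
      apply (noneigenvalue_qpow m); auto; lia. }
    assert (Hya : forall i, y i a = step (approx k) a i).
    { intros i; unfold y; rewrite Ek; cbn.
      now rewrite Ek, (proj2 (Nat.leb_gt _ _)) by lia. }
    rewrite (Csum_ext _ (fun k0 => Cmul (jacobian m n c j k0) (step (approx k) a k0)))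
      by (intros; now rewrite Hya).
    rewrite Hya, (Hst j Hj); f_equal.
    apply (comp_coef_nonlin_agree m n k); auto; [lia|].
    intros i Hi; apply shift_series_agree; auto.
Qed.

(** * Uniform bound on the resolvent *)

Lemma Rabs_fst_le x : Rabs (fst x) <= Cnorm x.
Proof.
  unfold Cnorm; rewrite <- sqrt_Rsqr_abs; apply sqrt_le_1_alt; unfold Rsqr; nra.
Qed.

Lemma Rabs_snd_le x : Rabs (snd x) <= Cnorm x.
Proof.
  unfold Cnorm; rewrite <- sqrt_Rsqr_abs; apply sqrt_le_1_alt; unfold Rsqr; nra.
Qed.

Lemma Cnorm_real s : 0 <= s -> Cnorm (s, 0) = s.
Proof.
  intros H; unfold Cnorm; cbn; replace (s * s + 0 * 0) with (s * s) by ring.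
  now apply sqrt_square.
Qed.

Lemma Cnorm_le_parts x : Cnorm x <= Rabs (fst x) + Rabs (snd x).
Proof.
  unfold Cnorm; rewrite <- (sqrt_square (Rabs (fst x) + Rabs (snd x))).
  - apply sqrt_le_1_alt.
    pose proof (Rabs_pos (fst x)); pose proof (Rabs_pos (snd x)).
    assert (E : forall t, t * t = Rabs t * Rabs t)
      by (intros t; rewrite <- Rabs_mult; symmetry; apply Rabs_pos_eq; nra).
    rewrite (E (fst x)), (E (snd x)); nra.
  - pose proof (Rabs_pos (fst x)); pose proof (Rabs_pos (snd x)); lra.
Qed.

(** * Sequential limits and convergent subsequences of complex numbers *)

Definition Ccv (u : nat -> Cplx) (l : Cplx) : Prop :=
  Un_cv (fun N => fst (u N)) (fst l) /\ Un_cv (fun N => snd (u N)) (snd l).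

Lemma Un_cv_const l : Un_cv (fun _ => l) l.
Proof. intros e He; exists 0%nat; intros; rewrite R_dist_eq; auto. Qed.

Lemma Ccv_const l : Ccv (fun _ => l) l.
Proof. split; apply Un_cv_const. Qed.

Lemma Ccv_add u v l k : Ccv u l -> Ccv v k -> Ccv (fun N => Cadd (u N) (v N)) (Cadd l k).
Proof. intros [] []; split; cbn; apply CV_plus; auto. Qed.

Lemma Ccv_mul u v l k : Ccv u l -> Ccv v k -> Ccv (fun N => Cmul (u N) (v N)) (Cmul l k).
Proof.
  intros [] []; split; cbn; [apply CV_minus|apply CV_plus]; apply CV_mult; auto.
Qed.

Lemma Ccv_sub u v l k : Ccv u l -> Ccv v k -> Ccv (fun N => Csub (u N) (v N)) (Csub l k).
Proof.
  intros [] []; split; cbn; apply (CV_plus _ (fun N => - _)); auto;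
    now apply (CV_opp (fun N => _ (v N))).
Qed.

Lemma Ccv_Csum {A} (f : A -> nat -> Cplx) g l :
  (forall x, In x l -> Ccv (f x) (g x)) ->
  Ccv (fun N => Csum (fun x => f x N) l) (Csum g l).
Proof.
  induction l as [|x l IH]; intros H; [apply (Ccv_const C0)|].
  apply (Ccv_add (f x) (fun N => Csum (fun x => f x N) l)); [apply H; now left|].
  apply IH; intros; apply H; now right.
Qed.

Lemma Un_cv_squeeze u v : (forall N, Rabs (u N) <= v N) -> Un_cv v 0 -> Un_cv u 0.
Proof.
  intros H Hv e He; destruct (Hv e He) as [N0 HN]; exists N0; intros N HN'.
  specialize (HN N HN'); specialize (H N); unfold Rdist in *.
  rewrite Rminus_0_r in *; pose proof (Rle_abs (v N)); lra.
Qed.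

Lemma Ccv_norm u l : Ccv u l -> Un_cv (fun N => Cnorm (Csub (u N) l)) 0.
Proof.
  intros [H1 H2].
  apply (Un_cv_squeeze _ (fun N => Rabs (fst (u N) - fst l) + Rabs (snd (u N) - snd l))).
  - intros N; rewrite Rabs_pos_eq by apply Cnorm_ge0; apply Cnorm_le_parts.
  - rewrite <- (Rplus_0_l 0); apply CV_plus.
    + intros e He; destruct (H1 e He) as [N0 H]; exists N0; intros N HN.
      unfold Rdist in *; rewrite Rminus_0_r, Rabs_Rabsolu; auto.
    + intros e He; destruct (H2 e He) as [N0 H]; exists N0; intros N HN.
      unfold Rdist in *; rewrite Rminus_0_r, Rabs_Rabsolu; auto.
Qed.

Lemma Un_cv_inv_S : Un_cv (fun N => / (INR N + 1)) 0.
Proof.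
  intros e He; destruct (archimed_cor1 e He) as (N0 & H & H0); exists N0; intros N HN.
  unfold Rdist; rewrite Rminus_0_r.
  assert (0 < INR N0) by now apply lt_0_INR.
  apply le_INR in HN; rewrite Rabs_pos_eq; [|left; apply Rinv_0_lt_compat; lra].
  eapply Rlt_trans; [|exact H]; apply Rinv_lt_contravar; nra.
Qed.

Lemma Ccv_small u l : (forall N, Cnorm (u N) <= / (INR N + 1)) -> Ccv u l -> l = C0.
Proof.
  intros Hs [H1 H2]; apply injective_projections.
  - apply (UL_sequence _ _ _ H1), (Un_cv_squeeze _ (fun N => / (INR N + 1))), Un_cv_inv_S.
    intros N; eapply Rle_trans; [apply Rabs_fst_le|apply Hs].
  - apply (UL_sequence _ _ _ H2), (Un_cv_squeeze _ (fun N => / (INR N + 1))), Un_cv_inv_S.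
    intros N; eapply Rle_trans; [apply Rabs_snd_le|apply Hs].
Qed.

Lemma Un_cv_reindex u l phi :
  (forall N, (N <= phi N)%nat) -> Un_cv u l -> Un_cv (fun N => u (phi N)) l.
Proof.
  intros Hp H e He; destruct (H e He) as [N0 HN]; exists N0; intros N HN'.
  apply HN; specialize (Hp N); lia.
Qed.

(** Bolzano-Weierstrass gives a cluster value, and [phi N] picks an index beyond [N] whose term is
    within [/ (INR N + 1)] of it. The condition [N <= phi N], weaker than strict monotonicity, is
    enough for limits to be inherited. *)
Lemma R_subsequence (u : nat -> R) B : (forall N, Rabs (u N) <= B) ->
  exists phi l, (forall N, (N <= phi N)%nat) /\ Un_cv (fun N => u (phi N)) l.
Proof.
  intros HB.
  destruct (Bolzano_Weierstrass u _ (compact_P3 (- B) B)) as [l Hl].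
  { intros N; specialize (HB N); unfold Rabs in HB; destruct (Rcase_abs (u N)); lra. }
  assert (H : forall N, exists p, (N <= p)%nat /\ Rabs (u p - l) <= / (INR N + 1)).
  { intros N.
    assert (Hp : 0 < / (INR N + 1)) by (apply Rinv_0_lt_compat; pose proof (pos_INR N); lra).
    destruct (Hl (disc l (mkposreal _ Hp)) N) as (p & Hp1 & Hp2).
    - exists (mkposreal _ Hp); intros x Hx; exact Hx.
    - exists p; split; auto; left; exact Hp2. }
  set (phi N := proj1_sig (constructive_indefinite_description _ (H N))).
  assert (Hphi : forall N, (N <= phi N)%nat /\ Rabs (u (phi N) - l) <= / (INR N + 1))
    by (intros N; apply (proj2_sig (constructive_indefinite_description _ (H N)))).
  exists phi, l; split; [apply Hphi|].
  assert (Hz : Un_cv (fun N => u (phi N) - l) 0)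
    by (apply (Un_cv_squeeze _ (fun N => / (INR N + 1))), Un_cv_inv_S; apply Hphi).
  intros e He; destruct (Hz e He) as [N0 HN]; exists N0; intros N HN'.
  specialize (HN N HN'); unfold Rdist in *; now rewrite Rminus_0_r in HN.
Qed.

(** Two extractions per coordinate, one for each of the real and imaginary parts; limits already
    obtained survive further reindexing. *)
Lemma Cplx_family_subsequence K (u : nat -> nat -> Cplx) B :
  (forall k N, (k < K)%nat -> Cnorm (u k N) <= B) ->
  exists phi l, (forall N, (N <= phi N)%nat) /\
    forall k, (k < K)%nat -> Ccv (fun N => u k (phi N)) (l k).
Proof.
  induction K as [|K IH]; intros HB.
  - exists (fun N => N), (fun _ => C0); split; [auto|intros; lia].
  - destruct IH as (phi & l & Hphi & Hl); [auto|].
    destruct (R_subsequence (fun N => fst (u K (phi N))) B) as (f1 & x & Hf1 & Hx).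
    { intros N; eapply Rle_trans; [apply Rabs_fst_le|auto]. }
    destruct (R_subsequence (fun N => snd (u K (phi (f1 N)))) B) as (f2 & y & Hf2 & Hy).
    { intros N; eapply Rle_trans; [apply Rabs_snd_le|auto]. }
    exists (fun N => phi (f1 (f2 N))), (fun k => if Nat.eqb k K then (x, y) else l k).
    split.
    { intros N; specialize (Hf2 N); specialize (Hf1 (f2 N)); specialize (Hphi (f1 (f2 N))); lia. }
    intros k Hk; destruct (Nat.eqb_spec k K) as [->|Hne].
    + split; cbn; auto.
      apply (Un_cv_reindex (fun N => fst (u K (phi (f1 N)))) x f2); auto.
    + destruct (Hl k) as [L1 L2]; [lia|].
      assert (Hf : forall N, (N <= f1 (f2 N))%nat)
        by (intros N; specialize (Hf2 N); specialize (Hf1 (f2 N)); lia).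
      split; [apply (Un_cv_reindex (fun N => fst (u k (phi N))) _ (fun N => f1 (f2 N)))|
              apply (Un_cv_reindex (fun N => snd (u k (phi N))) _ (fun N => f1 (f2 N)))]; auto.
Qed.

(** Residual of [v] in the eigenvector equation for [x], that is, [(x - D) v]. It allows the
    resolvent to be bounded without constructing an inverse matrix. *)
Definition defect (n : nat) (D : nat -> nat -> Cplx) (x : Cplx) (v : nat -> Cplx) (i : nat) :=
  Csub (Cmul x (v i)) (Csum (fun k => Cmul (D i k) (v k)) (seq 0 n)).

Lemma defect_scal n D x v s i :
  defect n D x (fun k => Cmul s (v k)) i = Cmul s (defect n D x v i).
Proof.
  unfold defect.
  rewrite (Csum_ext _ (fun k => Cmul s (Cmul (D i k) (v k)))) by (intros; cbv beta; ring).
  rewrite Csum_scal; ring.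
Qed.

(* A failing sequence of approximate eigenvectors for points of Q would, by compactness,
   accumulate at an eigenvector whose eigenvalue is a limit point of Q. *)
Lemma resolvent_bound m n q D :
  (forall lam, is_eigenvalue n D lam -> ~ in_Q m q lam) ->
  (forall lam, is_eigenvalue n D lam -> ~ limit_point_Q m q lam) ->
  exists K, 0 < K /\ forall a v j, length a = m -> (0 < total a)%nat -> (j < n)%nat ->
    Cnorm (v j) <= K * Rsum (fun i => Cnorm (defect n D (qpow q a) v i)) (seq 0 n).
Proof.
  intros Hres Hlim; apply NNPP; intros Hno.
  (* Taking [K = N + 1] in the negated claim gives a vector whose defects are small relative to its
     size; scaling by the inverse of its l1 norm [s] normalizes it. *)
  assert (H : forall N, exists p : midx * (nat -> Cplx),
    length (fst p) = m /\ (0 < total (fst p))%nat /\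
    Rsum (fun i => Cnorm (snd p i)) (seq 0 n) = 1 /\
    forall i, (i < n)%nat -> Cnorm (defect n D (qpow q (fst p)) (snd p) i) <= / (INR N + 1)).
  { intros N; apply NNPP; intros HN; apply Hno.
    assert (HN0 : 0 < INR N + 1) by (pose proof (pos_INR N); lra).
    exists (INR N + 1); split; auto; intros a v j Hl Ha Hj.
    apply Rnot_lt_le; intros Hlt; apply HN.
    set (s := Rsum (fun i => Cnorm (v i)) (seq 0 n)).
    set (E := Rsum (fun i => Cnorm (defect n D (qpow q a) v i)) (seq 0 n)) in *.
    assert (Hvs : Cnorm (v j) <= s).
    { apply (Rsum_member (fun i => Cnorm (v i))); [intros; apply Cnorm_ge0|apply in_seq; lia]. }
    assert (HE : 0 <= E) by (apply Rsum_ge0; intros; apply Cnorm_ge0).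
    assert (Hs : 0 < s) by nra.
    assert (Hs' : 0 < / s) by now apply Rinv_0_lt_compat.
    exists (a, fun i => Cmul (/ s, 0) (v i)); cbn [fst snd]; repeat split; auto.
    - rewrite (Rsum_ext _ (fun i => / s * Cnorm (v i))).
      + rewrite Rsum_scal; fold s; field; lra.
      + intros i _; rewrite Cnorm_mul, Cnorm_real; lra.
    - intros i Hi; rewrite defect_scal, Cnorm_mul, Cnorm_real by lra.
      assert (Hi' : Cnorm (defect n D (qpow q a) v i) <= E).
      { apply (Rsum_member (fun i => Cnorm (defect n D (qpow q a) v i)));
          [intros; apply Cnorm_ge0|apply in_seq; lia]. }
      apply Rmult_le_reg_l with (s * (INR N + 1)); [nra|].
      replace (s * (INR N + 1) * (/ s * Cnorm (defect n D (qpow q a) v i)))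
        with ((INR N + 1) * Cnorm (defect n D (qpow q a) v i)) by (field; lra).
      replace (s * (INR N + 1) * / (INR N + 1)) with s by (field; lra).
      nra. }
  set (p N := proj1_sig (constructive_indefinite_description _ (H N))).
  assert (Hp := fun N => proj2_sig (constructive_indefinite_description _ (H N))).
  fold p in Hp; change (forall N, length (fst (p N)) = m /\ (0 < total (fst (p N)))%nat /\
    Rsum (fun i => Cnorm (snd (p N) i)) (seq 0 n) = 1 /\
    forall i, (i < n)%nat ->
      Cnorm (defect n D (qpow q (fst (p N))) (snd (p N)) i) <= / (INR N + 1)) in Hp.
  clearbody p; clear H Hno.
  set (x N := qpow q (fst (p N))); set (w i N := snd (p N) i).
  assert (Hw1 : forall i N, (i < n)%nat -> Cnorm (w i N) <= 1).
  { intros i N Hi; destruct (Hp N) as (_ & _ & <- & _).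
    apply (Rsum_member (fun i => Cnorm (snd (p N) i)));
      [intros; apply Cnorm_ge0|apply in_seq; lia]. }
  (* The moduli of the coordinates sum to 1, so [Cnorm (x N)] is the sum of the norms of the
     coordinates of [x w]. Writing [x w] as defect plus [D w], with defects and coordinates at most
     1, gives a bound independent of [N]. *)
  set (B := Rsum (fun i => 1 + Rsum (fun k => Cnorm (D i k)) (seq 0 n)) (seq 0 n)).
  assert (Hx : forall N, Cnorm (x N) <= B).
  { intros N; destruct (Hp N) as (_ & _ & Hsum & Hdef).
    rewrite <- (Rmult_1_r (Cnorm (x N))), <- Hsum, <- Rsum_scal.
    apply Rsum_le; intros i Hi; apply in_seq in Hi.
    rewrite <- Cnorm_mul.
    replace (Cmul (x N) (snd (p N) i)) with (Cadd (defect n D (x N) (snd (p N)) i)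
      (Csum (fun k => Cmul (D i k) (snd (p N) k)) (seq 0 n))) by (unfold defect; ring).
    eapply Rle_trans; [apply Cnorm_add|]; apply Rplus_le_compat.
    - eapply Rle_trans; [apply Hdef; lia|].
      rewrite <- Rinv_1; apply Rinv_le_contravar; [lra|]; pose proof (pos_INR N); lra.
    - eapply Rle_trans; [apply Cnorm_Csum|]; apply Rsum_le; intros k Hk.
      apply in_seq in Hk; rewrite Cnorm_mul.
      rewrite <- (Rmult_1_r (Cnorm (D i k))) at 2.
      apply Rmult_le_compat_l; [apply Cnorm_ge0|apply Hw1; lia]. }
  (* Position [n] of the family holds the scalar and the positions below [n] hold the vector, so one
     extraction serves both; [l n] is the limiting scalar. *)
  destruct (Cplx_family_subsequence (S n) (fun k N => if Nat.eqb k n then x N else w k N)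
    (Rmax B 1)) as (phi & l & Hphi & Hl).
  { intros k N Hk; cbv beta; destruct (Nat.eqb_spec k n).
    - eapply Rle_trans; [apply Hx|apply Rmax_l].
    - eapply Rle_trans; [apply Hw1; lia|apply Rmax_r]. }
  assert (Hlx : Ccv (fun N => x (phi N)) (l n)).
  { specialize (Hl n ltac:(lia)); cbv beta in Hl; now rewrite Nat.eqb_refl in Hl. }
  assert (Hlw : forall i, (i < n)%nat -> Ccv (fun N => w i (phi N)) (l i)).
  { intros i Hi; specialize (Hl i ltac:(lia)); cbv beta in Hl.
    destruct (Nat.eqb_spec i n); [lia|auto]. }
  assert (He : is_eigenvalue n D (l n)).
  { exists l; split.
    (* A zero limit vector would force the l1 norms, all equal to 1, to tend to 0. *)
    - apply NNPP; intros Hall.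
      assert (Hz : Un_cv (fun N => Rsum (fun i => Cnorm (w i (phi N))) (seq 0 n)) 0).
      { assert (G : forall L, (forall i, In i L -> (i < n)%nat) ->
          Un_cv (fun N => Rsum (fun i => Cnorm (w i (phi N))) L) 0).
        { induction L as [|i L IH]; intros HL; [apply (Un_cv_const 0)|].
          rewrite <- (Rplus_0_l 0).
          apply (CV_plus (fun N => Cnorm (w i (phi N)))
            (fun N => Rsum (fun i => Cnorm (w i (phi N))) L)).
          - assert (E : l i = C0).
            { apply NNPP; intros Hne; apply Hall; exists i; split; auto; apply HL; now left. }
            pose proof (Ccv_norm _ _ (Hlw i (HL i (or_introl eq_refl)))) as C.
            rewrite E in C; eapply Un_cv_ext; [|exact C].
            intros N; cbv beta; f_equal; ring.
          - apply IH; intros; apply HL; now right. }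
        apply G; intros i Hi; apply in_seq in Hi; lia. }
      assert (R1 : Un_cv (fun N => Rsum (fun i => Cnorm (w i (phi N))) (seq 0 n)) 1).
      { eapply Un_cv_ext; [|apply (Un_cv_const 1)].
        intros N; destruct (Hp (phi N)) as (_ & _ & Hsum & _); symmetry; exact Hsum. }
      pose proof (UL_sequence _ _ _ Hz R1); lra.
    - intros j Hj; symmetry; apply Csub_eq0.
      apply (Ccv_small (fun N => defect n D (x (phi N)) (snd (p (phi N))) j)).
      + intros N; destruct (Hp (phi N)) as (_ & _ & _ & Hd).
        eapply Rle_trans; [apply Hd; auto|].
        pose proof (pos_INR N); pose proof (le_INR _ _ (Hphi N)).
        apply Rinv_le_contravar; lra.
      + apply Ccv_sub; [apply Ccv_mul; auto; apply (Hlw j Hj)|].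
        apply (Ccv_Csum (fun k N => Cmul (D j k) (w k (phi N)))
          (fun k => Cmul (D j k) (l k))).
        intros k Hk; apply in_seq in Hk; apply Ccv_mul; [apply Ccv_const|apply Hlw; lia]. }
  apply (Hlim _ He); intros eps Heps.
  destruct (Ccv_norm _ _ Hlx eps Heps) as [N0 HN0].
  specialize (HN0 N0 (le_n _)).
  unfold Rdist in HN0; rewrite Rminus_0_r, Rabs_pos_eq in HN0 by apply Cnorm_ge0.
  destruct (Hp (phi N0)) as (Hlen & Htot & _).
  exists (fst (p (phi N0))); repeat split; auto.
  - now apply is_zero_total_false.
  (* A limit point must be approached by values different from it; nonresonance rules out equality
     here. *)
  - intros E; apply (Hres _ He); exists (fst (p (phi N0))); repeat split; auto.
    now apply is_zero_total_false.
Qed.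

(** * Convergence *)

(** The left side sums over pairs [(b, idx_sub a b)]. These are distinct because their sum returns
    [a], and both entries have degree at most [d], so they form part of the full product of index
    sets. *)
Lemma Rsum_convolution m d (F G : midx -> R) :
  (forall a, 0 <= F a) -> (forall a, 0 <= G a) ->
  Rsum (fun a => Rsum (fun b => F b * G (idx_sub a b)) (below a)) (comps m d) <=
  Rsum F (comps m d) * Rsum G (comps m d).
Proof.
  intros HF HG.
  set (P (p : midx * midx) := F (fst p) * G (snd p)).
  assert (E1 : Rsum (fun a => Rsum (fun b => F b * G (idx_sub a b)) (below a)) (comps m d) =
    Rsum P (flat_map (fun a => map (fun b => (b, idx_sub a b)) (below a)) (comps m d))).
  { rewrite Rsum_flat_map; apply Rsum_ext; intros a _; now rewrite Rsum_map. }
  assert (E2 : Rsum F (comps m d) * Rsum G (comps m d) =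
    Rsum P (flat_map (fun b => map (pair b) (comps m d)) (comps m d))).
  { rewrite Rsum_flat_map, Rmult_comm, <- Rsum_scal; apply Rsum_ext; intros b _.
    rewrite Rsum_map; unfold P; cbn [fst snd]; rewrite Rsum_scal; ring. }
  rewrite E1, E2; apply Rsum_incl.
  - intros p; now apply Rmult_le_pos.
  - apply (NoDup_flat_map_retract _ (fun p => idx_add (fst p) (snd p))).
    + apply NoDup_comps.
    + intros a _; apply FinFun.Injective_map_NoDup; [|apply NoDup_below].
      intros b b' E; congruence.
    + intros a y Hy; apply in_map_iff in Hy as (b & <- & Hb); now apply idx_subK.
  - intros p Hp; apply in_flat_map in Hp as (a & Ha & Hp).
    apply in_map_iff in Hp as (b & <- & Hb).
    apply in_comps in Ha as [Hl Ht].
    pose proof (below_length a b Hb); pose proof (idx_sub_length a b Hb).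
    pose proof (idx_sub_total a b Hb).
    apply in_flat_map; exists b; split; [apply in_comps; lia|].
    apply in_map, in_comps; lia.
Qed.

(** * Truncated weighted norms of power series *)

Definition psnorm (m : nat) (rho : R) (d : nat) (f : ps) : R :=
  Rsum (fun a => Cnorm (f a) * rho ^ total a) (comps m d).

Lemma weighted_ge0 rho (x : Cplx) k : 0 <= rho -> 0 <= Cnorm x * rho ^ k.
Proof. intros H; apply Rmult_le_pos; [apply Cnorm_ge0|now apply pow_le]. Qed.

Lemma psnorm_ge0 m rho d f : 0 <= rho -> 0 <= psnorm m rho d f.
Proof. intros H; apply Rsum_ge0; intros; now apply weighted_ge0. Qed.

Lemma psnorm_mul m rho d f g : 0 <= rho ->
  psnorm m rho d (ps_mul f g) <= psnorm m rho d f * psnorm m rho d g.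
Proof.
  intros Hr; unfold psnorm.
  eapply Rle_trans; [|apply Rsum_convolution; intros; now apply weighted_ge0].
  apply Rsum_le; intros a _; unfold ps_mul.
  eapply Rle_trans; [apply Rmult_le_compat_r; [now apply pow_le|apply Cnorm_Csum]|].
  rewrite Rmult_comm, <- Rsum_scal; apply Req_le, Rsum_ext; intros b Hb.
  rewrite Cnorm_mul, <- (idx_sub_total a b Hb), pow_add; ring.
Qed.

Lemma psnorm_one m rho d : psnorm m rho d ps_one <= 1.
Proof.
  unfold psnorm.
  assert (Hz : In (zero_idx m) (comps m d)).
  { apply in_comps; rewrite total_zero_idx; unfold zero_idx; rewrite repeat_length; lia. }
  destruct (in_split _ _ Hz) as (l1 & l2 & E).
  pose proof (NoDup_comps m d) as Hn; rewrite E in Hn.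
  rewrite E, (Rsum_perm _ _ (zero_idx m :: l1 ++ l2)) by
    (symmetry; apply Permutation_middle).
  cbn [Rsum fold_right]; fold (Rsum (fun a => Cnorm (ps_one a) * rho ^ total a) (l1 ++ l2)).
  assert (Hpos : forall a, In a (l1 ++ l2) -> (0 < total a)%nat).
  { intros a Ha; destruct (Nat.eq_dec (total a) 0) as [T|]; [exfalso|lia].
    apply (NoDup_remove_2 _ _ _ Hn).
    assert (Ha' : In a (comps m d)) by (rewrite E; rewrite in_app_iff in *; cbn; tauto).
    apply in_comps in Ha' as [Hl _]; apply total0_zero_idx in T; congruence. }
  rewrite (Rsum_ext _ (fun _ => 0)) by
    (intros a Ha; rewrite (ps_one_pos a (Hpos a Ha)), Cnorm_0; ring).
  rewrite Rsum_const, total_zero_idx, ps_one_total0, Cnorm_1 by apply total_zero_idx.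
  cbn [pow]; lra.
Qed.

Lemma psnorm_pow m rho d f s x : 0 <= rho -> psnorm m rho d f <= s ->
  psnorm m rho d (ps_pow f x) <= s ^ x.
Proof.
  intros Hr Hf; induction x as [|x IH]; cbn [ps_pow pow]; [apply psnorm_one|].
  eapply Rle_trans; [now apply psnorm_mul|].
  apply Rmult_le_compat; auto using psnorm_ge0.
Qed.

Lemma psnorm_prod_pows m rho d z s i g : 0 <= rho ->
  (forall j, (i <= j < i + length g)%nat -> psnorm m rho d (z j) <= s) ->
  psnorm m rho d (ps_prod_pows z i g) <= s ^ total g.
Proof.
  intros Hr; revert i; induction g as [|x g IH]; intros i Hz; [apply psnorm_one|].
  rewrite total_cons, pow_add; cbn [ps_prod_pows length] in *.
  eapply Rle_trans; [now apply psnorm_mul|].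
  apply Rmult_le_compat; auto using psnorm_ge0.
  - apply psnorm_pow; auto; apply Hz; lia.
  - apply IH; intros j Hj; apply Hz; lia.
Qed.

(** Majorant principle: the norm of the composition is bounded by the truncated series of absolute
    values, evaluated with [rho] for each [t] and [s] for each [z]. *)
Lemma psnorm_comp_coef m n rho d c z s : 0 <= rho ->
  (forall i, (i < n)%nat -> psnorm m rho d (z i) <= s) ->
  psnorm m rho d (comp_coef n c z) <=
  Rsum (fun b => Rsum (fun g =>
    Cnorm (c b g) * rho ^ total b * s ^ total g) (comps n d)) (comps m d).
Proof.
  intros Hr Hz.
  set (T a b g := Cnorm (c b g) * rho ^ total b *
         (Cnorm (ps_prod_pows z 0 g (idx_sub a b)) * rho ^ total (idx_sub a b))).
  assert (HT : forall a b g, 0 <= T a b g)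
    by (intros; apply Rmult_le_pos; now apply weighted_ge0).
  apply Rle_trans with
    (Rsum (fun a => Rsum (fun b => Rsum (T a b) (comps n d)) (below a)) (comps m d)).
  - apply Rsum_le; intros a Ha; apply in_comps in Ha as [_ Ha]; unfold comp_coef.
    eapply Rle_trans; [apply Rmult_le_compat_r; [now apply pow_le|apply Cnorm_Csum]|].
    rewrite Rmult_comm, <- Rsum_scal; apply Rsum_le; intros b Hb.
    eapply Rle_trans; [apply Rmult_le_compat_l; [now apply pow_le|apply Cnorm_Csum]|].
    rewrite <- Rsum_scal.
    apply Rle_trans with (Rsum (T a b) (comps n (total a))).
    + apply Req_le, Rsum_ext; intros g _; unfold T.
      rewrite Cnorm_mul, <- (idx_sub_total a b Hb), pow_add; ring.
    + apply Rsum_incl; auto using NoDup_comps.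
      intros g; rewrite !in_comps; lia.
  (* With the sum over [g] moved outermost, each fixed [g] leaves a convolution of a coefficient
     sequence with the coefficients of one monomial in [z]. *)
  - rewrite (Rsum_ext _ (fun a => Rsum (fun g => Rsum (fun b => T a b g) (below a)) (comps n d)))
      by (intros; apply Rsum_swap).
    rewrite Rsum_swap, (Rsum_swap (fun b g => Cnorm (c b g) * rho ^ total b * s ^ total g)).
    apply Rsum_le; intros g Hg; apply in_comps in Hg as [Hg _].
    eapply Rle_trans.
    { apply (Rsum_convolution m d (fun b => Cnorm (c b g) * rho ^ total b)
        (fun b => Cnorm (ps_prod_pows z 0 g b) * rho ^ total b));
        intros; now apply weighted_ge0. }
    rewrite (Rsum_ext (fun b => Cnorm (c b g) * rho ^ total b * s ^ total g)
      (fun b => s ^ total g * (Cnorm (c b g) * rho ^ total b))) by (intros; ring).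
    rewrite Rsum_scal, Rmult_comm.
    apply Rmult_le_compat_r; [apply Rsum_ge0; intros; now apply weighted_ge0|].
    apply psnorm_prod_pows; auto; intros j Hj; apply Hz; lia.
Qed.

(** * Majorants for the nonlinear part and the convergence proof *)

Lemma pow_le_scaled u e k : 0 <= u <= 1 -> (e <= k)%nat -> u ^ k <= u ^ e.
Proof.
  intros Hu Hk; replace k with (e + (k - e))%nat by lia; rewrite pow_add.
  rewrite <- (Rmult_1_r (u ^ e)) at 2; apply Rmult_le_compat_l; [now apply pow_le|].
  rewrite <- (pow1 (k - e)); now apply pow_incr.
Qed.

(** Shrinking the radii from [r] to [u * r] in [t] and [v * r] in [z] gains a factor [u] when [b] is
    nonzero and [v ^ 2] when [g] has degree at least two. Each term kept by [nonlin] is in one of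
    these cases. *)
Lemma nonlin_weight_le c b g r u v : 0 <= r -> 0 <= u <= 1 -> 0 <= v <= 1 ->
  Cnorm (nonlin c b g) * (u * r) ^ total b * (v * r) ^ total g <=
  (u + v ^ 2) * (Cnorm (c b g) * r ^ (total b + total g)).
Proof.
  intros Hr Hu Hv; pose proof (weighted_ge0 r (c b g) (total b + total g) Hr) as Hw.
  assert (Hv2 : 0 <= v ^ 2) by (apply pow_le; lra).
  unfold nonlin; destruct (is_zero_idx b && (total g <=? 1)%nat)%bool eqn:E.
  - rewrite Cnorm_0, !Rmult_0_l; apply Rmult_le_pos; lra.
  - rewrite !Rpow_mult_distr.
    replace (Cnorm (c b g) * (u ^ total b * r ^ total b) * (v ^ total g * r ^ total g))
      with (u ^ total b * v ^ total g * (Cnorm (c b g) * r ^ (total b + total g)))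
      by (rewrite pow_add; ring).
    apply Rmult_le_compat_r; auto.
    assert (H1 : forall t k, 0 <= t <= 1 -> 0 <= t ^ k <= 1).
    { intros t k Ht; split; [now apply pow_le|].
      replace 1 with (t ^ 0) by reflexivity; apply pow_le_scaled; auto; lia. }
    pose proof (H1 u (total b) Hu); pose proof (H1 v (total g) Hv).
    apply Bool.andb_false_iff in E as [E|E].
    + apply is_zero_total_false in E.
      pose proof (pow_le_scaled u 1 (total b) Hu E) as Hb; rewrite pow_1 in Hb; nra.
    + apply Nat.leb_gt in E.
      pose proof (pow_le_scaled v 2 (total g) Hv E); nra.
Qed.

(** Finitely many components share the smallest of their radii and the largest of their bounds. *)
Lemma analytic_coeffs_uniform m n c N :
  (forall j, (j < N)%nat -> analytic_coeffs m n (c j)) ->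
  exists r M, 0 < r /\ 0 <= M /\ forall j d, (j < N)%nat ->
    Rsum (fun b => Rsum (fun g =>
       Cnorm (c j b g) * r ^ (total b + total g)) (comps n d)) (comps m d) <= M.
Proof.
  induction N as [|N IH]; intros H.
  - exists 1, 0; repeat split; [lra|lra|intros; lia].
  - destruct IH as (r & M & Hr & HM & HrM); [auto|].
    destruct (H N (le_n _)) as (r' & M' & Hr' & HrM').
    assert (Hm : 0 < Rmin r r') by now apply Rmin_glb_lt.
    exists (Rmin r r'), (Rmax M M'); repeat split; auto.
    { eapply Rle_trans; [exact HM|apply Rmax_l]. }
    assert (Hmono : forall j d s, Rmin r r' <= s ->
      Rsum (fun b => Rsum (fun g => Cnorm (c j b g) * (Rmin r r') ^ (total b + total g))
        (comps n d)) (comps m d) <=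
      Rsum (fun b => Rsum (fun g => Cnorm (c j b g) * s ^ (total b + total g))
        (comps n d)) (comps m d)).
    { intros j d s Hs; apply Rsum_le; intros b _; apply Rsum_le; intros g _.
      apply Rmult_le_compat_l; [apply Cnorm_ge0|apply pow_incr; lra]. }
    intros j d Hj; destruct (Nat.eq_dec j N) as [->|].
    + eapply Rle_trans; [apply (Hmono _ _ r'), Rmin_r|].
      eapply Rle_trans; [apply HrM'|apply Rmax_r].
    + eapply Rle_trans; [apply (Hmono _ _ r), Rmin_l|].
      eapply Rle_trans; [apply HrM; lia|apply Rmax_l].
Qed.

Definition trunc (k : nat) (f : ps) : ps := fun a => if (total a <=? k)%nat then f a else C0.

Lemma solution_converges m n q Y c y :
  (forall j, (j < n)%nat -> analytic_coeffs m n (c j)) ->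
  (forall j, (j < n)%nat -> c j (zero_idx m) (zero_idx n) = Y j) ->
  (forall lam, is_eigenvalue n (jacobian m n c) lam -> ~ in_Q m q lam) ->
  (forall lam, is_eigenvalue n (jacobian m n c) lam -> ~ limit_point_Q m q lam) ->
  is_solution m n q Y c y -> forall j, (j < n)%nat -> ps_converges m (y j).
Proof.
  intros Hhol Hfix Hres Hlim Hy.
  apply (solution_recursion m n q Y c _ Hfix) in Hy as [H0 Hs].
  destruct (analytic_coeffs_uniform m n c n Hhol) as (r & M & Hr & HM & HrM).
  destruct (resolvent_bound m n q _ Hres Hlim) as (K & HK & HKb).
  set (z := shift_series y).
  set (A := K * (INR n * M)).
  assert (HA : 0 <= A) by
    (unfold A; apply Rmult_le_pos; [lra|apply Rmult_le_pos; [apply pos_INR|lra]]).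
  (* u and v are chosen so that A (u + v^2) <= v r *)
  set (v := / (1 + 2 * A / r)).
  set (u := v ^ 2).
  assert (HAr : 0 <= 2 * A / r) by
    (apply Rmult_le_pos; [lra|left; now apply Rinv_0_lt_compat]).
  assert (Hv : 0 < v <= 1).
  { unfold v; split; [apply Rinv_0_lt_compat; lra|].
    rewrite <- Rinv_1; apply Rinv_le_contravar; lra. }
  assert (Hu : 0 < u <= 1) by (unfold u; nra).
  assert (Huv : A * (u + v ^ 2) <= v * r).
  (* As [u = v ^ 2], the left side is [2 * A * v ^ 2], and [v * (1 + 2 * A / r) = 1] bounds the
     excess factor by 1. *)
  { replace (A * (u + v ^ 2)) with (v * r * (v * (2 * A / r))) by (unfold u; field; lra).
    assert (v * (2 * A / r) <= 1).
    { apply Rle_trans with (v * (1 + 2 * A / r)); [nra|].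
      apply Req_le; unfold v; field; split; [|lra].
      apply Rgt_not_eq; nra. }
    assert (0 < v * r) by nra; nra. }
  assert (Hur : 0 < u * r) by nra.
  (* The radius [u * r] and the bound [v * r] depend neither on the truncation degree [k] nor on the
     cutoff [d] of the norm; this uniformity yields convergence. *)
  assert (Hbound : forall k d j, (j < n)%nat ->
    psnorm m (u * r) d (trunc k (z j)) <= v * r).
  { induction k as [|k IH]; intros d j Hj.
    - unfold psnorm; rewrite (Rsum_ext _ (fun _ => 0)), Rsum_const; [nra|].
      intros a _; unfold trunc, z, shift_series.
      destruct (Nat.leb_spec (total a) 0); [|rewrite Cnorm_0; ring].
      rewrite (proj2 (is_zero_total a)), Cnorm_0 by lia; ring.
    - set (z' i := trunc k (z i)).
      set (N i a := comp_coef n (nonlin (c i)) z' a).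
      (* The defect of the coefficient vector at [a] is the nonlinear part at [a], and in degree at
         most [k + 1] it depends only on the truncation [z'], so the resolvent bound applies with
         known data. *)
      assert (Hcoef : forall a, length a = m ->
        Cnorm (trunc (S k) (z j) a) <= K * Rsum (fun i => Cnorm (N i a)) (seq 0 n)).
      { intros a Hl.
        assert (Hpos : 0 <= K * Rsum (fun i => Cnorm (N i a)) (seq 0 n)).
        { apply Rmult_le_pos; [lra|]; apply Rsum_ge0; intros; apply Cnorm_ge0. }
        unfold trunc; destruct (Nat.leb_spec (total a) (S k)) as [Hk|];
          [|now rewrite Cnorm_0].
        unfold z, shift_series; destruct (is_zero_idx a) eqn:Ez; [now rewrite Cnorm_0|].
        apply is_zero_total_false in Ez.
        eapply Rle_trans; [apply (HKb a (fun i => y i a) j Hl Ez Hj)|].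
        apply Rmult_le_compat_l; [lra|]; apply Req_le, Rsum_ext; intros i Hi.
        apply in_seq in Hi; f_equal; unfold defect; rewrite Hs by (auto; lia).
        transitivity (comp_coef n (nonlin (c i)) (shift_series y) a); [ring|].
        apply (comp_coef_nonlin_agree m n k); auto.
        intros i' _ b _; unfold z', trunc, z, shift_series; split; intros Hb.
        - rewrite (proj2 (is_zero_total b)) by lia; now destruct (_ <=? _)%nat.
        - rewrite (proj2 (Nat.leb_le _ _)); auto; lia. }
      apply Rle_trans with (K * Rsum (fun i => psnorm m (u * r) d (N i)) (seq 0 n)).
      + unfold psnorm; rewrite Rsum_swap, <- Rsum_scal; apply Rsum_le; intros a Ha.
        apply in_comps in Ha as [Hl _].
        eapply Rle_trans; [apply Rmult_le_compat_r; [apply pow_le; lra|now apply Hcoef]|].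
        rewrite Rmult_assoc, (Rmult_comm (Rsum _ _)), <- Rsum_scal.
        apply Req_le; f_equal; apply Rsum_ext; intros; ring.
      + apply Rle_trans with (K * (INR n * ((u + v ^ 2) * M))).
        2: { eapply Rle_trans; [|exact Huv]; unfold A; apply Req_le; ring. }
        apply Rmult_le_compat_l; [lra|].
        rewrite <- (length_seq n 0) at 2; rewrite <- (Rsum_const _ (seq 0 n)).
        apply Rsum_le; intros i Hi; apply in_seq in Hi.
        eapply Rle_trans.
        { apply (psnorm_comp_coef m n _ d _ z' (v * r)); [lra|].
          intros; now apply IH. }
        eapply Rle_trans.
        { apply Rsum_le; intros b _; apply Rsum_le; intros g _.
          apply (nonlin_weight_le (c i) b g r u v); lra. }
        rewrite (Rsum_ext _ (fun b => (u + v ^ 2) * Rsum (fun g =>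
           Cnorm (c i b g) * r ^ (total b + total g)) (comps n d)))
          by (intros; now rewrite Rsum_scal).
        rewrite Rsum_scal; apply Rmult_le_compat_l; [nra|apply HrM; lia]. }
  (* Truncating at [k = d] changes nothing in degrees up to [d]; the constant term [Y j], removed by
     the shift, is added back through [ps_one]. *)
  intros j Hj; exists (u * r), (Cnorm (Y j) + v * r); split; auto; intros d.
  eapply Rle_trans; [|apply Rplus_le_compat; [|apply (Hbound d d j Hj)]].
  - apply Rle_trans with (Rsum (fun a => Cnorm (Y j) * (Cnorm (ps_one a) * (u * r) ^ total a) +
      Cnorm (trunc d (z j) a) * (u * r) ^ total a) (comps m d)).
    + apply Rsum_le; intros a Ha; apply in_comps in Ha as [Hl Hd].
      unfold trunc, z, shift_series, ps_one; rewrite (proj2 (Nat.leb_le _ _) Hd).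
      destruct (is_zero_idx a) eqn:E; rewrite ?Cnorm_0, ?Cnorm_1; [|lra].
      apply is_zero_total, total0_zero_idx in E; rewrite Hl in E.
      rewrite E, H0 by auto; lra.
    + rewrite Rsum_add; apply Req_le; reflexivity.
  - rewrite Rsum_scal; rewrite <- (Rmult_1_r (Cnorm (Y j))) at 2.
    apply Rmult_le_compat_l; [apply Cnorm_ge0|apply psnorm_one].
Qed.

Theorem mainTheorem10 (m n : nat) (Hm : (1 <= m)%nat) (Hn : (1 <= n)%nat)
  (q : nat -> Cplx) (Hq : forall i, (i < m)%nat -> q i <> C0)
  (Y : nat -> Cplx) (c : nat -> midx -> midx -> Cplx)
  (Hhol : forall j, (j < n)%nat -> analytic_coeffs m n (c j))
  (Hfix : forall j, (j < n)%nat -> c j (zero_idx m) (zero_idx n) = Y j)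
  (Hnonres : forall lam, is_eigenvalue n (jacobian m n c) lam -> ~ in_Q m q lam) :
  (exists y : nat -> ps, is_solution m n q Y c y /\
     forall y' : nat -> ps, is_solution m n q Y c y' ->
       forall j a, (j < n)%nat -> length a = m -> y' j a = y j a)
  /\
  ((forall lam, is_eigenvalue n (jacobian m n c) lam -> ~ limit_point_Q m q lam) ->
   forall y : nat -> ps, is_solution m n q Y c y ->
     forall j, (j < n)%nat -> ps_converges m (y j)).
Proof.
  split.
  - destruct (solution_exists m n q Y c Hfix Hnonres) as [y Hy].
    exists y; split; [exact Hy|].
    intros y' Hy'; exact (solution_unique m n q Y c y y' Hfix Hnonres Hy Hy').
  - intros Hlim y Hy; exact (solution_converges m n q Y c y Hhol Hfix Hnonres Hlim Hy).
Qed.
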